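(* Let $\Bbbk$ be a field and let $A$ and $B$ be finite-dimensional $\Bbbk$-algebras. If there is a surjective homomorphism of unital $\Bbbk$-algebras $\varphi:B\to A$, then $B\leq_J A$.
   Context: All algebras are finite-dimensional, associative, unital $\Bbbk$-algebras, and all (bi)modules are finite-dimensional. For $\Bbbk$-algebras $A,B$ one writes $A\geq_J B$ (equivalently $B\leq_J A$) if there are bimodules ${}_AM_B$ and ${}_BN_A$ such that $M\otimes_B N\simeq A\oplus X$ as $A$-$A$-bimodules for some $A$-$A$-bimodule $X$. *)

(* Defs.v *)
From HB Require Import structures.
From mathcomp Require Import all_boot all_order all_algebra all_field.

Set Implicit Arguments.
Unset Strict Implicit.
Unset Printing Implicit Defensive.

Import GRing.Theory VectorInternalTheory.
Local Open Scope ring_scope.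

Definition bilinear_map (K : fieldType) (U V W : lmodType K)
    (f : U -> V -> W) : Prop :=
  (forall u, linear (f u)) /\ (forall v, linear (f^~ v)).

(* [falgType K] requires [1 != 0]; this record is the same notion without that
   requirement, so that the zero algebra is covered ([fdalg_of_falg]). *)
Record fdAlgebra (K : fieldType) := FDAlgebra {
  fdalg_vect : vectType K;
  fdalg_one : fdalg_vect;
  fdalg_mul : fdalg_vect -> fdalg_vect -> fdalg_vect;
  fdalg_mul_bilinear : bilinear_map fdalg_mul;
  fdalg_mulA : associative fdalg_mul;
  fdalg_mul1 : left_id fdalg_one fdalg_mul;
  fdalg_mulr1 : right_id fdalg_one fdalg_mul
}.

Definition fdalg_sort (K : fieldType) (A : fdAlgebra K) : Type := fdalg_vect A.
Coercion fdalg_sort : fdAlgebra >-> Sortclass.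

Section FDAlgebraRing.
Variables (K : fieldType) (A : fdAlgebra K).

HB.instance Definition _ := Vector.on (fdalg_sort A).

Fact fdalg_mulDl : left_distributive (@fdalg_mul K A) +%R.
Proof.
move=> x y z; have [_ /(_ z 1 x y)] := fdalg_mul_bilinear A.
by rewrite !scale1r.
Qed.

Fact fdalg_mulDr : right_distributive (@fdalg_mul K A) +%R.
Proof.
move=> x y z; have [/(_ x 1 y z) + _] := fdalg_mul_bilinear A.
by rewrite !scale1r.
Qed.

HB.instance Definition _ := GRing.Zmodule_isPzRing.Build (fdalg_sort A)
  (@fdalg_mulA K A) (@fdalg_mul1 K A) (@fdalg_mulr1 K A)
  fdalg_mulDl fdalg_mulDr.

Lemma fdalg_mulE (x y : A) : x * y = fdalg_mul x y. Proof. by []. Qed.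

Lemma mul_bilinear : bilinear_map (fun x y : A => x * y).
Proof. exact: fdalg_mul_bilinear. Qed.

End FDAlgebraRing.

Fact falg_mul_bilinear (K : fieldType) (A : falgType K) :
  bilinear_map (fun x y : A => x * y).
Proof.
by split=> [x|y] k u v; rewrite ?mulrDr ?mulrDl -?scalerAr -?scalerAl.
Qed.

Definition fdalg_of_falg (K : fieldType) (A : falgType K) : fdAlgebra K :=
  @FDAlgebra K A 1 (fun x y => x * y) (falg_mul_bilinear A)
    (@mulrA A) (@mul1r A) (@mulr1 A).

(* Bilinearity of both actions makes K act centrally: the left and right
   actions of K obtained through A and B both coincide with [*:]. *)
Record bimodule (K : fieldType) (A B : fdAlgebra K) := Bimodule {
  bimod_sort :> vectType K;
  lact : A -> bimod_sort -> bimod_sort;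
  ract : bimod_sort -> B -> bimod_sort;
  lact_bilinear : bilinear_map lact;
  ract_bilinear : bilinear_map ract;
  lact1 : forall m, lact 1 m = m;
  lactM : forall a a' m, lact (a * a') m = lact a (lact a' m);
  ract1 : forall m, ract m 1 = m;
  ractM : forall m b b', ract m (b * b') = ract (ract m b) b';
  lract : forall a m b, ract (lact a m) b = lact a (ract m b)
}.

Definition bimod_iso (K : fieldType) (A B : fdAlgebra K)
    (M N : bimodule A B) : Prop :=
  exists f : {linear M -> N},
    [/\ bijective f,
        forall a m, f (lact a m) = lact a (f m)
      & forall m b, f (ract m b) = ract (f m) b].

Section RegularBimodule.
Variables (K : fieldType) (A : fdAlgebra K).

Definition regular_bimod : bimodule A A :=
  @Bimodule K A A [the vectType K of fdalg_sort A]
    (fun a x => a * x) (fun x a => x * a) (mul_bilinear A) (mul_bilinear A)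
    (@mul1r A) (fun a b x => esym (mulrA a b x))
    (@mulr1 A) (@mulrA A) (fun a x b => esym (mulrA a x b)).

End RegularBimodule.

Section DirectSum.
Variables (K : fieldType) (A B : fdAlgebra K) (M N : bimodule A B).

Let dsum_lact (a : A) (x : M * N) : M * N := (lact a x.1, lact a x.2).
Let dsum_ract (x : M * N) (b : B) : M * N := (ract x.1 b, ract x.2 b).

Fact dsum_lact_bilinear : bilinear_map dsum_lact.
Proof.
have [[lM rM] [lN rN]] := (lact_bilinear M, lact_bilinear N).
split=> [a|x] k u v; rewrite /dsum_lact; congr pair;
  by rewrite /= ?lM ?rM ?lN ?rN.
Qed.

Fact dsum_ract_bilinear : bilinear_map dsum_ract.
Proof.
have [[lM rM] [lN rN]] := (ract_bilinear M, ract_bilinear N).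
split=> [a|x] k u v; rewrite /dsum_ract; congr pair;
  by rewrite /= ?lM ?rM ?lN ?rN.
Qed.

Fact dsum_lact1 x : dsum_lact 1 x = x.
Proof. by case: x => x y; rewrite /dsum_lact !lact1. Qed.

Fact dsum_lactM a a' x : dsum_lact (a * a') x = dsum_lact a (dsum_lact a' x).
Proof. by rewrite /dsum_lact !lactM. Qed.

Fact dsum_ract1 x : dsum_ract x 1 = x.
Proof. by case: x => x y; rewrite /dsum_ract !ract1. Qed.

Fact dsum_ractM x b b' : dsum_ract x (b * b') = dsum_ract (dsum_ract x b) b'.
Proof. by rewrite /dsum_ract !ractM. Qed.

Fact dsum_lract a x b :
  dsum_ract (dsum_lact a x) b = dsum_lact a (dsum_ract x b).
Proof. by rewrite /dsum_ract /dsum_lact !lract. Qed.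

Definition dsum_bimod : bimodule A B :=
  @Bimodule K A B [the vectType K of (M * N)%type] dsum_lact dsum_ract
    dsum_lact_bilinear dsum_ract_bilinear dsum_lact1 dsum_lactM
    dsum_ract1 dsum_ractM dsum_lract.

End DirectSum.

(* The tensor product of V and W over K, in coordinates: the pure tensor
   v (x) w is the rank one matrix with entries v_i * w_j. *)
Section TensorOverField.
Variables (K : fieldType) (V W : vectType K).

Definition tensK : vectType K := [the vectType K of 'M[K]_(dim V, dim W)].

Definition pureK (v : V) (w : W) : tensK := (v2r v)^T *m v2r w.

Definition liftK (U : vectType K) (f : V -> W -> U)
    (t : 'M[K]_(dim V, dim W)) : U :=
  \sum_i \sum_j t i j *: f (r2v (delta_mx 0 i)) (r2v (delta_mx 0 j)).

Lemma pureK_bilinear : bilinear_map pureK.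
Proof.
split=> [u|w] k x y; rewrite /pureK linearP.
- by rewrite mulmxDr scalemxAr.
- by rewrite linearP mulmxDl scalemxAl.
Qed.

Lemma liftK_linear (U : vectType K) (f : V -> W -> U) : linear (liftK f).
Proof.
move=> k s t; rewrite /liftK scaler_sumr -big_split; apply: eq_bigr => i _.
rewrite scaler_sumr -big_split; apply: eq_bigr => j _.
by rewrite !mxE scalerDl scalerA.
Qed.

Lemma liftK_pure (U : vectType K) (f : V -> W -> U) v w :
  bilinear_map f -> liftK f (pureK v w) = f v w.
Proof.
case=> fl fr.
pose fL u : {linear W -> U} :=
  HB.pack (f u) (GRing.isLinear.Build K W U _ (f u) (fl u)).
pose fR z : {linear V -> U} :=
  HB.pack (f^~ z) (GRing.isLinear.Build K V U _ (f^~ z) (fr z)).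
rewrite -{2}(v2rK v) -{2}(v2rK w) [v2r v]row_sum_delta [v2r w]row_sum_delta.
rewrite !linear_sum /= -[f _ _]/(fR _ _) linear_sum /=; apply: eq_bigr => i _.
rewrite -[f _ _]/(fL _ _) linear_sum /=; apply: eq_bigr => j _.
have fZr k x y : f x (k *: y) = k *: f x y by exact: (linearZ_LR (fL x)).
have fZl k x y : f (k *: x) y = k *: f x y by exact: (linearZ_LR (fR y)).
rewrite !linearZ /= fZr fZl scalerA mulrC.
by rewrite mxE big_ord_recl big_ord0 addr0 !mxE mulrC.
Qed.

Lemma tensK_ext (U : vectType K) (f g : tensK -> U) : linear f -> linear g ->
  (forall v w, f (pureK v w) = g (pureK v w)) -> f =1 g.
Proof.
move=> fl gl fg t.
pose fL : {linear tensK -> U} :=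
  HB.pack f (GRing.isLinear.Build K tensK U _ f fl).
pose gL : {linear tensK -> U} :=
  HB.pack g (GRing.isLinear.Build K tensK U _ g gl).
rewrite -[f t]/(fL t) -[g t]/(gL t) (matrix_sum_delta t) !linear_sum.
apply: eq_bigr => i _; rewrite !linear_sum; apply: eq_bigr => j _.
rewrite !linearZ; congr (_ *: _).
suff -> : delta_mx i j = pureK (r2v (delta_mx 0 i)) (r2v (delta_mx 0 j)).
  exact: fg.
by rewrite /pureK !r2vK trmx_delta mul_delta_mx.
Qed.

End TensorOverField.

(* V / U, realised on a complement of U through the projection that kills U. *)
Section Quotient.
Variables (K : fieldType) (V : vectType K) (U : {vspace V}).

Definition quot : vectType K := [the vectType K of subvs_of (U^C)%VS].

Definition quot_val (x : quot) : V := vsval x.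

Definition quot_proj (v : V) : quot :=
  vsproj (U^C)%VS (daddv_pi (U^C)%VS U v).

Fact quot_val_linear : linear quot_val.
Proof. exact: linearP. Qed.
HB.instance Definition _ :=
  GRing.isLinear.Build K quot V _ quot_val quot_val_linear.

Fact quot_proj_linear : linear quot_proj.
Proof. by move=> k u v; rewrite /quot_proj !linearP. Qed.
HB.instance Definition _ :=
  GRing.isLinear.Build K V quot _ quot_proj quot_proj_linear.

Let cap0 : (U^C :&: U = 0)%VS.
Proof. by rewrite capvC capv_compl. Qed.

Lemma quot_valK : cancel quot_val quot_proj.
Proof. by move=> x; rewrite /quot_proj daddv_pi_id ?subvsP // vsvalK. Qed.

Lemma quot_projK v : quot_val (quot_proj v) - v \in U.
Proof.
have dv : daddv_pi (U^C)%VS U v + daddv_pi U (U^C)%VS v = v.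
  by apply: daddv_pi_add => //; rewrite addvC addv_complf memvf.
rewrite /quot_val /quot_proj vsprojK ?memv_pi // -{2}dv opprD addrA subrr.
by rewrite sub0r memvN memv_pi.
Qed.

Lemma quot_proj_eq0 v : (quot_proj v == 0) = (v \in U).
Proof.
apply/eqP/idP => [v0|vU].
  by have := quot_projK v; rewrite v0 linear0 sub0r memvN.
suff v0 : quot_val (quot_proj v) = 0 by rewrite -[LHS]quot_valK v0 linear0.
apply/eqP; rewrite -memv0 -cap0 memv_cap subvsP /=.
by rewrite -(subrK v (quot_val _)) memvD // quot_projK.
Qed.

End Quotient.

(* M (x)_B N is the quotient of M (x)_K N by the subspace spanned by all
   m b (x) n - m (x) b n.  The span is taken with m, b and n running over bases;
   by multilinearity this is the same subspace ([mem_tens_rel] and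
   [tens_rel_min]). *)
Section TensorProduct.
Variables (K : fieldType) (A B C : fdAlgebra K).
Variables (M : bimodule A B) (N : bimodule B C).

Definition tens_relator (m : M) (b : B) (n : N) : tensK M N :=
  pureK (ract m b) n - pureK m (lact b n).

Definition tens_rel : {vspace tensK M N} :=
  <<[seq tens_relator mb.1 mb.2 n |
       mb <- [seq (m, b) | m <- vbasis {:M}, b <- vbasis {:B}],
       n <- vbasis {:N}]>>%VS.

Definition tens_sort : vectType K := quot tens_rel.

Definition tens (m : M) (n : N) : tens_sort :=
  quot_proj tens_rel (pureK m n).

Definition balanced (U : vectType K) (f : M -> N -> U) : Prop :=
  forall m b n, f (ract m b) n = f m (lact b n).

Definition tens_lift (U : vectType K) (f : M -> N -> U) (t : tens_sort) : U :=
  liftK f (quot_val t).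

Lemma tens_rel_min (U : {vspace tensK M N}) :
  (forall m b n, tens_relator m b n \in U) -> (tens_rel <= U)%VS.
Proof. by move=> h; apply/span_subvP => _ /allpairsP[p [_ _ ->]]. Qed.

Lemma mem_tens_rel m b n : tens_relator m b n \in tens_rel.
Proof.
have [pl pr] := pureK_bilinear M N.
have [ll lr] := lact_bilinear N; have [rl rr] := ract_bilinear M.
have from_basis (V : vectType K) (g : V -> tensK M N) : linear g ->
    {in vbasis {:V}, forall v, g v \in tens_rel} -> forall v, g v \in tens_rel.
  move=> gl gb v.
  pose gL : {linear V -> tensK M N} :=
    HB.pack g (GRing.isLinear.Build K V (tensK M N) _ g gl).
  rewrite (coord_vbasis (memvf v)) -[g _]/(gL _) linear_sum memv_suml // => i _.
  by rewrite linearZ memvZ // gb // mem_nth ?size_tuple.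
apply: (from_basis _ (fun m => tens_relator m b n)) => [k u v|m' hm].
  by rewrite /tens_relator rr !pr scalerBr opprD addrACA.
apply: (from_basis _ (fun b => tens_relator m' b n)) => [k u v|b' hb].
  by rewrite /tens_relator rl lr pr pl scalerBr opprD addrACA.
apply: (from_basis _ (fun n => tens_relator m' b' n)) => [k u v|n' hn].
  by rewrite /tens_relator ll !pl scalerBr opprD addrACA.
apply/memv_span/allpairsP; exists ((m', b'), n'); split=> //.
exact: allpairs_f.
Qed.

Lemma tens_bilinear : bilinear_map tens.
Proof.
have [pl pr] := pureK_bilinear M N.
by split=> [u|w] k x y; rewrite /tens ?pl ?pr linearP.
Qed.

Lemma tens_balanced : balanced tens.
Proof.
move=> m b n; apply/eqP.
by rewrite -subr_eq0 -linearB quot_proj_eq0 mem_tens_rel.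
Qed.

Lemma tens_lift_linear (U : vectType K) (f : M -> N -> U) :
  linear (tens_lift f).
Proof. by move=> k s t; rewrite /tens_lift linearP liftK_linear. Qed.

Lemma tens_liftE (U : vectType K) (f : M -> N -> U) m n :
  bilinear_map f -> balanced f -> tens_lift f (tens m n) = f m n.
Proof.
move=> fbil fbal.
pose fL : {linear tensK M N -> U} := HB.pack (liftK f)
  (GRing.isLinear.Build K (tensK M N) U _ (liftK f) (liftK_linear f)).
rewrite -(liftK_pure m n fbil); apply/eqP; rewrite /tens_lift.
rewrite -subr_eq0 -[liftK f _]/(fL _) -[liftK f (pureK m n)]/(fL _) -linearB.
have sR : (tens_rel <= lker (linfun fL))%VS.
  apply: tens_rel_min => m' b n'; rewrite memv_ker lfunE linearB /=.
  by rewrite !liftK_pure // fbal subrr.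
have := subvP sR _ (quot_projK tens_rel (pureK m n)).
by rewrite memv_ker lfunE.
Qed.

Lemma tens_ext (U : vectType K) (f g : tens_sort -> U) :
  linear f -> linear g ->
  (forall m n, f (tens m n) = g (tens m n)) -> f =1 g.
Proof.
move=> fl gl fg t; rewrite -(quot_valK t).
have := @tensK_ext _ _ _ _ (f \o quot_proj tens_rel) (g \o quot_proj tens_rel).
apply=> //.
- by move=> k u v /=; rewrite linearP fl.
- by move=> k u v /=; rewrite linearP gl.
Qed.

Let tens_lact (a : A) : tens_sort -> tens_sort :=
  tens_lift (fun m n => tens (lact a m) n).
Let tens_ract (t : tens_sort) (c : C) : tens_sort :=
  tens_lift (fun m n => tens m (ract n c)) t.

Fact tens_lactE a m n : tens_lact a (tens m n) = tens (lact a m) n.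
Proof.
have [tl tr] := tens_bilinear; have [ll lr] := lact_bilinear M.
rewrite /tens_lact tens_liftE //; first split=> [u|w] k x y.
- exact: tl.
- by rewrite /= ll tr.
- by move=> m' b n'; rewrite -lract tens_balanced.
Qed.

Fact tens_ractE m n c : tens_ract (tens m n) c = tens m (ract n c).
Proof.
have [tl tr] := tens_bilinear; have [rl rr] := ract_bilinear N.
rewrite /tens_ract tens_liftE //; first split=> [u|w] k x y.
- by rewrite /= rr tl.
- exact: tr.
- by move=> m' b n'; rewrite lract tens_balanced.
Qed.

Let lin_lact a : linear (tens_lact a). Proof. exact: tens_lift_linear. Qed.
Let lin_ract c : linear (tens_ract^~ c). Proof. exact: tens_lift_linear. Qed.
Let lin_id : linear (@id tens_sort). Proof. by []. Qed.
Let lin_comp (f g : tens_sort -> tens_sort) :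
  linear f -> linear g -> linear (fun t => f (g t)).
Proof. by move=> fl gl k u v; rewrite gl fl. Qed.
Let lin_comb (k : K) (f g : tens_sort -> tens_sort) :
  linear f -> linear g -> linear (fun t => k *: f t + g t).
Proof.
move=> fl gl l u v; rewrite fl gl !scalerDr !scalerA mulrC.
by rewrite addrACA -!scalerA.
Qed.

Fact tens_lact_bilinear : bilinear_map tens_lact.
Proof.
split=> [a|t k a a']; first exact: lin_lact.
have [tl tr] := tens_bilinear; have [ll lr] := lact_bilinear M.
apply: (tens_ext (lin_lact _) (lin_comb k (lin_lact a) (lin_lact a'))) => m n.
by rewrite !tens_lactE lr tr.
Qed.

Fact tens_ract_bilinear : bilinear_map tens_ract.
Proof.
split=> [t k c c'|c]; last exact: lin_ract.
have [tl tr] := tens_bilinear; have [rl rr] := ract_bilinear N.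
apply: (tens_ext (lin_ract _) (lin_comb k (lin_ract c) (lin_ract c'))) => m n.
by rewrite !tens_ractE rl tl.
Qed.

Fact tens_lact1 t : tens_lact 1 t = t.
Proof.
by apply: (tens_ext (lin_lact _) lin_id) => m n; rewrite tens_lactE lact1.
Qed.

Fact tens_lactM a a' t : tens_lact (a * a') t = tens_lact a (tens_lact a' t).
Proof.
apply: (tens_ext (lin_lact _) (lin_comp (lin_lact a) (lin_lact a'))) => m n.
by rewrite !tens_lactE lactM.
Qed.

Fact tens_ract1 t : tens_ract t 1 = t.
Proof.
by apply: (tens_ext (lin_ract _) lin_id) => m n; rewrite tens_ractE ract1.
Qed.

Fact tens_ractM t c c' : tens_ract t (c * c') = tens_ract (tens_ract t c) c'.
Proof.
apply: (tens_ext (lin_ract _) (lin_comp (lin_ract c') (lin_ract c))) => m n.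
by rewrite !tens_ractE ractM.
Qed.

Fact tens_lract a t c :
  tens_ract (tens_lact a t) c = tens_lact a (tens_ract t c).
Proof.
apply: (tens_ext (lin_comp (lin_ract c) (lin_lact a))
                 (lin_comp (lin_lact a) (lin_ract c))) => m n.
by rewrite !(tens_lactE, tens_ractE).
Qed.

Definition tens_bimod : bimodule A C :=
  @Bimodule K A C tens_sort tens_lact tens_ract
    tens_lact_bilinear tens_ract_bilinear tens_lact1 tens_lactM
    tens_ract1 tens_ractM tens_lract.

Lemma lact_tens a m n : lact a (tens m n : tens_bimod) = tens (lact a m) n.
Proof. exact: tens_lactE. Qed.

Lemma ract_tens m n c : ract (tens m n : tens_bimod) c = tens m (ract n c).
Proof. exact: tens_ractE. Qed.

End TensorProduct.

Definition geJ (K : fieldType) (A B : fdAlgebra K) : Prop :=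
  exists (M : bimodule A B) (N : bimodule B A) (X : bimodule A A),
    bimod_iso (tens_bimod M N) (dsum_bimod (regular_bimod A) X).

Definition leJ (K : fieldType) (B A : fdAlgebra K) : Prop := geJ A B.

(* Main.v *)
From HB Require Import structures.
Require Import Defs.
From mathcomp Require Import all_boot all_order all_algebra all_field.

(** View A as a bimodule over A and B, on either side, by letting B act through
    phi.  The right action of A on any C-A-bimodule M is B-balanced, so it
    induces a map M (x)_B A -> M, with section m |-> m (x) 1.  The section is
    also a left inverse because phi is onto: if a = phi b, then
    m (x) a = m (x) b 1 = m b (x) 1 = m a (x) 1 ([tens_surjE]).  Hence M (x)_B A
    is isomorphic to M ([tens_restr_iso]).  For M = A this exhibits A itself as
    a tensor product through B, so the complement X can be taken to be 0. *)

Set Implicit Arguments.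
Unset Strict Implicit.
Unset Printing Implicit Defensive.

Import GRing.Theory.
Local Open Scope ring_scope.

Lemma bimod_iso_trans (K : fieldType) (A B : fdAlgebra K)
    (M N P : bimodule A B) :
  bimod_iso M N -> bimod_iso N P -> bimod_iso M P.
Proof.
move=> [f [fbij fl fr]] [g [gbij gl gr]]; exists (g \o f); split.
- exact: bij_comp.
- by move=> a m /=; rewrite fl gl.
- by move=> m b /=; rewrite fr gr.
Qed.

Section ZeroBimodule.
Variables (K : fieldType) (A B : fdAlgebra K).

Lemma rV0_eq (x y : 'rV[K]_0) : x = y.
Proof. by rewrite [x]thinmx0 [y]thinmx0. Qed.

Let zero_bilinear (U V : lmodType K) (f : U -> V -> 'rV[K]_0) :
  bilinear_map f.
Proof. by split=> [u|v] k x y; exact: rV0_eq. Qed.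

Definition zero_bimod : bimodule A B :=
  @Bimodule K A B [the vectType K of 'rV[K]_0] (fun _ x => x) (fun x _ => x)
    (zero_bilinear _) (zero_bilinear _)
    (fun=> erefl) (fun _ _ _ => erefl) (fun=> erefl) (fun _ _ _ => erefl)
    (fun _ _ _ => erefl).

Lemma dsum_zero_iso (M : bimodule A B) : bimod_iso M (dsum_bimod M zero_bimod).
Proof.
pose i (m : M) : dsum_bimod M zero_bimod := (m, 0).
have i_lin : linear i.
  by move=> k x y; congr pair; exact: rV0_eq.
pose iL : {linear M -> dsum_bimod M zero_bimod} :=
  HB.pack i (GRing.isLinear.Build K M (dsum_bimod M zero_bimod) _ i i_lin).
exists iL; split=> //; exists fst => // -[m z].
by congr pair; exact: rV0_eq.
Qed.

End ZeroBimodule.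

Section Restriction.
Variables (K : fieldType) (A B : fdAlgebra K) (phi : {linear B -> A}).
Hypothesis phi_morph : GRing.monoid_morphism phi.

Let phi1 : phi 1 = 1. Proof. by case: phi_morph. Qed.
Let phiM : {morph phi : x y / x * y}. Proof. by case: phi_morph. Qed.

Section RestrictLeft.
Variables (C : fdAlgebra K) (M : bimodule A C).

Let res_lact (b : B) (m : M) : M := lact (phi b) m.

Fact res_lact_bilinear : bilinear_map res_lact.
Proof.
have [ll lr] := lact_bilinear M.
by split=> [b|m] k x y; rewrite /res_lact ?linearP; [exact: ll | exact: lr].
Qed.

Fact res_lact1 m : res_lact 1 m = m.
Proof. by rewrite /res_lact phi1 lact1. Qed.

Fact res_lactM b b' m : res_lact (b * b') m = res_lact b (res_lact b' m).
Proof. by rewrite /res_lact phiM lactM. Qed.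

Definition restrict_left : bimodule B C :=
  @Bimodule K B C M res_lact (@ract K A C M) res_lact_bilinear
    (ract_bilinear M) res_lact1 res_lactM (@ract1 K A C M) (@ractM K A C M)
    (fun b => @lract K A C M (phi b)).

End RestrictLeft.

Section RestrictRight.
Variables (C : fdAlgebra K) (M : bimodule C A).

Let res_ract (m : M) (b : B) : M := ract m (phi b).

Fact res_ract_bilinear : bilinear_map res_ract.
Proof.
have [rl rr] := ract_bilinear M.
by split=> [m|b] k x y; rewrite /res_ract ?linearP; [exact: rl | exact: rr].
Qed.

Fact res_ract1 m : res_ract m 1 = m.
Proof. by rewrite /res_ract phi1 ract1. Qed.

Fact res_ractM m b b' : res_ract m (b * b') = res_ract (res_ract m b) b'.
Proof. by rewrite /res_ract phiM ractM. Qed.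

Definition restrict_right : bimodule C B :=
  @Bimodule K C B M (@lact K C A M) res_ract (lact_bilinear M)
    res_ract_bilinear (@lact1 K C A M) (@lactM K C A M) res_ract1 res_ractM
    (fun c m b => @lract K C A M c m (phi b)).

End RestrictRight.

Hypothesis phi_surj : forall a : A, exists b : B, phi b = a.

Section TensorWithTarget.
Variables (C : fdAlgebra K) (M : bimodule C A).

Notation MB := (restrict_right M).
Notation AB := (restrict_left (regular_bimod A)).

(** A scalar a = phi b is the action of b on 1, and the tensor product over B
    lets b cross to the left factor, where it again acts as a. *)
Lemma tens_surjE (m : M) (a : A) :
  tens (m : MB) (a : AB) = tens (ract m a : MB) ((1 : A) : AB).
Proof.
have [b <-] := phi_surj a.
have phi_b : (phi b : AB) = lact b ((1 : A) : AB) by rewrite /= mulr1.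
by rewrite [in LHS]phi_b -tens_balanced.
Qed.

(** Restriction of scalars along a surjection is fully faithful, so extending
    scalars back undoes it; the inverse of the action map is m |-> m (x) 1. *)
Lemma tens_restr_iso : bimod_iso (tens_bimod MB AB) M.
Proof.
pose act : MB -> AB -> M := @ract K C A M.
have act_bil : bilinear_map act := ract_bilinear M.
have act_bal : balanced act by move=> m b a; rewrite /act /= ractM.
pose f : tens_bimod MB AB -> M := tens_lift act.
have f_lin : linear f by exact: tens_lift_linear.
have fE m a : f (tens m a) = ract (m : M) (a : A) by exact: tens_liftE.
have [tl tr] := tens_bilinear MB AB.
have [ll lr] := lact_bilinear M; have [rl rr] := ract_bilinear M.
have [tll _] := lact_bilinear (tens_bimod MB AB).
have [_ trr] := ract_bilinear (tens_bimod MB AB).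
pose fL : {linear tens_bimod MB AB -> M} :=
  HB.pack f (GRing.isLinear.Build K (tens_bimod MB AB) M _ f f_lin).
exists fL; split.
- exists (fun m => tens (m : MB) ((1 : A) : AB)) => [t|m] /=; last first.
    by rewrite fE ract1.
  apply: (@tens_ext _ _ _ _ MB AB _ (fun t => tens (f t : MB) _) id) => //.
    by move=> k u v; rewrite f_lin tr.
  by move=> m a; rewrite fE -tens_surjE.
- move=> c /=.
  apply: (@tens_ext _ _ _ _ MB AB _ (fun t => f (lact c (t : tens_bimod MB AB)))
           (fun t => lact c (f t))).
  + by move=> k u v; rewrite tll f_lin.
  + by move=> k u v; rewrite f_lin ll.
  + by move=> m a; rewrite lact_tens !fE lract.
- move=> t a /=; move: t.
  apply: (@tens_ext _ _ _ _ MB AB _ (fun t => f (ract (t : tens_bimod MB AB) a))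
           (fun t => ract (f t) a)).
  + by move=> k u v; rewrite trr f_lin.
  + by move=> k u v; rewrite f_lin rr.
  + by move=> m a'; rewrite ract_tens !fE -ractM.
Qed.

End TensorWithTarget.
End Restriction.

Theorem proposition8 (K : fieldType) (A B : fdAlgebra K)
    (phi : {linear B -> A}) (phi_morph : GRing.monoid_morphism phi)
    (phi_surj : forall a : A, exists b : B, phi b = a) :
  leJ B A.
Proof.
exists (restrict_right phi_morph (regular_bimod A)).
exists (restrict_left phi_morph (regular_bimod A)), (zero_bimod A A).
exact: bimod_iso_trans (tens_restr_iso phi_morph phi_surj _) (dsum_zero_iso _).
Qed.
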